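(* The unary negation fragment $\mathrm{UNFO}$ and $\mathrm{GRA}(e,p,s,I,\neg_1,J,\overline{J},\exists)$ are equiexpressive; that is, every formula of $\mathrm{UNFO}$ has an equivalent term of $\mathrm{GRA}(e,p,s,I,\neg_1,J,\overline{J},\exists)$, and every term of $\mathrm{GRA}(e,p,s,I,\neg_1,J,\overline{J},\exists)$ has an equivalent formula of $\mathrm{UNFO}$.
   Context: AD-relations. $A^0=\{\epsilon\}$, with $\epsilon$ the empty tuple. A $k$-ary AD-relation over a set $A$ is a pair $(R,k)$ with $R\subseteq A^k$, $k\ge 0$; $t\in(R,k)$ means $t\in R$. Vocabularies contain only relation symbols (of any arity $k\ge 0$). Models have nonempty domains; $A$ is the domain of $\mathfrak{A}$. Terms. $\mathrm{GRA}(e,p,s,I,\neg_1,J,\overline{J},\exists)$ is the set of terms built from relation symbols and the constant $e$ by the unary operators $p,s,I,\neg_1,\exists$ and the binary operators $J,\overline{J}$. Each term $\mathcal{T}$ defines in each model $\mathfrak{A}$ an AD-relation $\mathcal{T}^{\mathfrak{A}}$ of arity $\mathit{ar}(\mathcal{T})$. Let $k=\mathit{ar}(\mathcal{T})$, $\ell=\mathit{ar}(\mathcal{S})$. - $R^{\mathfrak{A}}$ is the interpretation of $R$, paired with the arity of $R$; $e^{\mathfrak{A}}=(\{(a,a)\mid a\in A\},2)$. - If $k\ge2$: $(p\mathcal{T})^{\mathfrak{A}}=(\{(a_k,a_1,\dots,a_{k-1})\mid(a_1,\dots,a_k)\in\mathcal{T}^{\mathfrak{A}}\},k)$; $(s\mathcal{T})^{\mathfrak{A}}=(\{(a_1,\dots,a_{k-2},a_k,a_{k-1})\mid(a_1,\dots,a_k)\in\mathcal{T}^{\mathfrak{A}}\},k)$;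 $(I\mathcal{T})^{\mathfrak{A}}=(\{(a_1,\dots,a_{k-1})\mid(a_1,\dots,a_k)\in\mathcal{T}^{\mathfrak{A}},\ a_{k-1}=a_k\},k-1)$. If $k\le1$, each of $p\mathcal{T},s\mathcal{T},I\mathcal{T}$ is interpreted as $\mathcal{T}^{\mathfrak{A}}$. - One-dimensional negation: if $k\le1$, $(\neg_1\mathcal{T})^{\mathfrak{A}}=(\{t\in A^k\mid t\notin\mathcal{T}^{\mathfrak{A}}\},k)$; otherwise $(\neg_1\mathcal{T})^{\mathfrak{A}}=(\varnothing,0)$. - $(J(\mathcal{T},\mathcal{S}))^{\mathfrak{A}}=(\{(a_1,\dots,a_k,b_1,\dots,b_\ell)\in A^{k+\ell}\mid(a_1,\dots,a_k)\in\mathcal{T}^{\mathfrak{A}}\text{ and }(b_1,\dots,b_\ell)\in\mathcal{S}^{\mathfrak{A}}\},k+\ell)$. - $(\overline{J}(\mathcal{T},\mathcal{S}))^{\mathfrak{A}}=(\{(a_1,\dots,a_k,b_1,\dots,b_\ell)\in A^{k+\ell}\mid(a_1,\dots,a_k)\in\mathcal{T}^{\mathfrak{A}}\text{ or }(b_1,\dots,b_\ell)\in\mathcal{S}^{\mathfrak{A}}\},k+\ell)$. - If $k\ge1$: $(\exists\mathcal{T})^{\mathfrak{A}}=(\{(a_1,\dots,a_{k-1})\mid(a_1,\dots,a_k)\in\mathcal{T}^{\mathfrak{A}}\text{ for some }a_k\in A\},k-1)$; if $k=0$: $(\exists\mathcal{T})^{\mathfrak{A}}=\mathcal{T}^{\mathfrak{A}}$.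 $\mathrm{UNFO}$ is the set of formulas generated by $\varphi::=x=y\mid R(x_1,\dots,x_k)\mid\varphi\wedge\varphi\mid\varphi\vee\varphi\mid\exists x\,\varphi\mid\neg\varphi(x)$, where $R$ is a relation symbol and the negated formula $\varphi(x)$ has at most one free variable. Variables come from $\{v_1,v_2,\dots\}$. Equivalence. A formula $\varphi$ whose free variables are exactly $v_{i_1},\dots,v_{i_k}$ with $i_1<\dots<i_k$ defines $\varphi^{\mathfrak{A}}=(\{(a_1,\dots,a_k)\in A^k\mid\mathfrak{A}\models\varphi(a_1,\dots,a_k)\},k)$, where $a_j$ is assigned to $v_{i_j}$. A formula $\varphi$ and a term $\mathcal{T}$ are equivalent if $\varphi^{\mathfrak{A}}=\mathcal{T}^{\mathfrak{A}}$ for every model $\mathfrak{A}$ whose vocabulary contains all symbols of $\varphi$ and $\mathcal{T}$. *)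

(* Defs.v *)
From mathcomp Require Import all_boot.
From mathcomp Require Import boolp classical_sets.

Set Implicit Arguments.
Unset Strict Implicit.
Unset Printing Implicit Defensive.

Local Open Scope classical_set_scope.

Record ad_relation (A : Type) := ADRelation {
  arity : nat;
  tuples : set (arity.-tuple A) }.
Arguments ADRelation {A} arity tuples.
Arguments arity {A} _.
Arguments tuples {A} _ _.

Section Operators.
Variable A : Type.
Implicit Types T S : ad_relation A.

Definition ad_e : ad_relation A :=
  ADRelation 2 [set [tuple a; a] | a in [set: A]].

Definition ad_p T : ad_relation A :=
  if 2 <= arity T then
    ADRelation (arity T) [set [tuple of rotr 1 u] | u in tuples T]
  else T.

Definition ad_s T : ad_relation A :=
  if 2 <= arity T then
    ADRelation (arity T) [set t | exists2 u, tuples T u &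
      exists w a b, u = w ++ [:: a; b] :> seq A /\ t = w ++ [:: b; a] :> seq A]
  else T.

Definition ad_I T : ad_relation A :=
  if 2 <= arity T then
    ADRelation (arity T).-1 [set t | exists2 u, tuples T u &
      exists w a, u = w ++ [:: a; a] :> seq A /\ t = w ++ [:: a] :> seq A]
  else T.

Definition ad_neg1 T : ad_relation A :=
  if arity T <= 1 then ADRelation (arity T) (~` tuples T)
  else ADRelation 0 set0.

Definition ad_J T S : ad_relation A :=
  ADRelation (arity T + arity S)
    [set t | exists (u : (arity T).-tuple A) (v : (arity S).-tuple A),
      t = [tuple of u ++ v] /\ (tuples T u /\ tuples S v)].

Definition ad_Jbar T S : ad_relation A :=
  ADRelation (arity T + arity S)
    [set t | exists (u : (arity T).-tuple A) (v : (arity S).-tuple A),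
      t = [tuple of u ++ v] /\ (tuples T u \/ tuples S v)].

Definition ad_exists T : ad_relation A :=
  if 1 <= arity T then
    ADRelation (arity T).-1 [set t | exists2 u, tuples T u &
      exists a, u = rcons t a :> seq A]
  else T.

End Operators.

Section Syntax.
(* Sym is the pool of all relation symbols; a vocabulary is a subset of it. *)
Variables (Sym : Type) (ar : Sym -> nat).

Record model := Model {
  vocabulary : set Sym;
  domain : Type;
  domain_nonempty : inhabited domain;
  interp : forall R, vocabulary R -> set ((ar R).-tuple domain) }.

(* A symbol outside the vocabulary holds of no tuple; this convention is never
   used by [equivalent], which only considers models interpreting all the
   symbols involved. *)
Definition holds (M : model) (R : Sym) : set ((ar R).-tuple (domain M)) :=
  [set t | exists h : vocabulary M R, interp h t].

Inductive gra_term :=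
  | TRel of Sym
  | Te
  | Tp of gra_term
  | Ts of gra_term
  | TI of gra_term
  | Tneg1 of gra_term
  | TJ of gra_term & gra_term
  | TJbar of gra_term & gra_term
  | Texists of gra_term.

Fixpoint term_symbols (T : gra_term) : set Sym :=
  match T with
  | TRel R => [set R]
  | Te => set0
  | Tp T | Ts T | TI T | Tneg1 T | Texists T => term_symbols T
  | TJ T1 T2 | TJbar T1 T2 => term_symbols T1 `|` term_symbols T2
  end.

Fixpoint term_rel (M : model) (T : gra_term) : ad_relation (domain M) :=
  match T with
  | TRel R => ADRelation (ar R) (@holds M R)
  | Te => ad_e (domain M)
  | Tp T => ad_p (term_rel M T)
  | Ts T => ad_s (term_rel M T)
  | TI T => ad_I (term_rel M T)
  | Tneg1 T => ad_neg1 (term_rel M T)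
  | TJ T1 T2 => ad_J (term_rel M T1) (term_rel M T2)
  | TJbar T1 T2 => ad_Jbar (term_rel M T1) (term_rel M T2)
  | Texists T => ad_exists (term_rel M T)
  end.

(* The variable v_(i+1) is represented by the number i. *)
Inductive formula :=
  | Eq of nat & nat
  | Rel (R : Sym) of (ar R).-tuple nat
  | And of formula & formula
  | Or of formula & formula
  | Ex of nat & formula
  | Neg of formula.

Fixpoint formula_symbols (phi : formula) : set Sym :=
  match phi with
  | Eq _ _ => set0
  | Rel R _ => [set R]
  | And phi psi | Or phi psi => formula_symbols phi `|` formula_symbols psi
  | Ex _ phi | Neg phi => formula_symbols phi
  end.

Fixpoint free_occurrences (phi : formula) : seq nat :=
  match phi with
  | Eq x y => [:: x; y]
  | Rel _ xs => xs
  | And phi psi | Or phi psi => free_occurrences phi ++ free_occurrences psi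
  | Ex x phi => [seq y <- free_occurrences phi | y != x]
  | Neg phi => free_occurrences phi
  end.

(* The free variables, without repetition and in increasing order. *)
Definition free_vars (phi : formula) : seq nat :=
  sort leq (undup (free_occurrences phi)).

Fixpoint unfo (phi : formula) : bool :=
  match phi with
  | Eq _ _ | Rel _ _ => true
  | And phi psi | Or phi psi => unfo phi && unfo psi
  | Ex _ phi => unfo phi
  | Neg phi => unfo phi && (size (free_vars phi) <= 1)
  end.

Fixpoint sat (M : model) (s : nat -> domain M) (phi : formula) : Prop :=
  match phi with
  | Eq x y => s x = s y
  | Rel R xs => @holds M R [tuple of map s xs]
  | And phi psi => sat s phi /\ sat s psi
  | Or phi psi => sat s phi \/ sat s psi
  | Ex x phi => exists a, sat (fun y => if y == x then a else s y) phi
  | Neg phi => ~ sat s phi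
  end.

(* The assignment s extends t to all variables; its values on variables that
   are not free in phi are irrelevant to [sat], and some s exists because the
   domain is nonempty. *)
Definition formula_rel (M : model) (phi : formula) : ad_relation (domain M) :=
  ADRelation (size (free_vars phi))
    [set t | exists2 s : nat -> domain M,
      t = [seq s x | x <- free_vars phi] :> seq (domain M) & sat s phi].

Definition equivalent (phi : formula) (T : gra_term) : Prop :=
  forall M : model,
    formula_symbols phi `|` term_symbols T `<=` vocabulary M ->
    formula_rel M phi = term_rel M T.

End Syntax.

(* Main.v *)
(** In both directions a term [T] is matched with a formula [phi] along a list
    [xs] of variables naming the columns of [T]. Repetitions in [xs] are
    allowed, so that [J] and [Jbar] translate conjunction and disjunction by
    mere concatenation of the lists. From formulas to terms, [p] and [s] generate
    all permutations of [xs] and [I] merges equal columns, so [xs] can be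
    normalised before each quantification. From terms to formulas, variables
    are kept apart by renaming free and bound variables simultaneously along an
    injection, for which no capture can occur. *)

Require Import Defs.
From mathcomp Require Import all_boot.
From mathcomp Require Import boolp classical_sets.

(** Plain sequences replace tuples here, so that relations whose arities are only provably equal can
    be compared without casts. *)
Definition rel_mem {A : Type} (X : ad_relation A) (t : seq A) : Prop :=
  exists2 u, tuples X u & t = u :> seq A.

(** * Membership in the results of the operators on AD-relations *)

Section RelMem.
Set Implicit Arguments.
Unset Strict Implicit.
Context {A : Type}.
Implicit Types (X Y : ad_relation A) (t w : seq A) (a b : A).

Lemma rel_mem_size X t : rel_mem X t -> size t = arity X.
Proof. by case=> u _ ->; rewrite size_tuple. Qed.

Lemma rel_mem_tuple X (u : (arity X).-tuple A) : rel_mem X u <-> tuples X u.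
Proof. by split=> [[v Xv /val_inj ->]|Xu] //; exists u. Qed.

Lemma ad_relation_eq X Y :
  arity X = arity Y -> (forall t, rel_mem X t <-> rel_mem Y t) -> X = Y.
Proof.
case: X Y => [k P] [l Q] /= kl; subst l => PQ; congr ADRelation.
apply/predeqP => u.
by have := PQ u; rewrite (rel_mem_tuple (X := ADRelation k P)) (rel_mem_tuple (X := ADRelation k Q)).
Qed.

Lemma arity_ad_p X : arity (ad_p X) = arity X.
Proof. by rewrite /ad_p; case: ifP. Qed.

Lemma arity_ad_s X : arity (ad_s X) = arity X.
Proof. by rewrite /ad_s; case: ifP. Qed.

Lemma arity_ad_I X : arity (ad_I X) = if 2 <= arity X then (arity X).-1 else arity X.
Proof. by rewrite /ad_I; case: ifP. Qed.

Lemma arity_ad_exists X : arity (ad_exists X) = (arity X).-1.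
Proof. by rewrite /ad_exists; case: ifP => //; case: (arity X). Qed.

(** No bound on the arity is required: rotating a list of length at most one changes nothing, which
    agrees with the identity clause of [ad_p]. *)
Lemma rel_mem_p X t : rel_mem (ad_p X) t <-> rel_mem X (rot 1 t).
Proof.
rewrite /ad_p; case: ifP => [X2|/negbT].
  split=> [[_ [u Xu <-] ->] /=|[u Xu tu]].
    by rewrite rotrK; apply/rel_mem_tuple.
  exists [tuple of rotr 1 u] => /=; first by exists u.
  by rewrite -tu rotK.
rewrite -ltnNge ltnS => X1; have rot1 : size t <= 1 -> rot 1 t = t.
  by case: t => [|? []].
split=> Xt; first by rewrite rot1 // (rel_mem_size Xt).
by rewrite -rot1 // -(size_rot 1) (rel_mem_size Xt).
Qed.

(** At arity below 2 both sides fail, since the displayed lists have length at least 2. *)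
Lemma rel_mem_s X w a b :
  rel_mem (ad_s X) (w ++ [:: a; b]) <-> rel_mem X (w ++ [:: b; a]).
Proof.
rewrite /ad_s; case: ifP => [X2|/negbT X1]; last first.
  by split=> /rel_mem_size Xt; move: X1; rewrite -Xt size_cat addn2.
split=> [[t [u Xu [w' [a' [b' [uE tE]]]]] wE]|[u Xu uE]].
  move: tE; rewrite -wE !(cats1, =^~ cat_rcons) => /rcons_inj [/rcons_inj [-> ->] ->].
  by exists u => //; rewrite uE -cat_rcons cats1.
have sz : size (w ++ [:: a; b]) == arity X.
  by rewrite -(size_tuple u) -uE !size_cat.
exists (Tuple sz) => //=; exists u => //.
by exists w, b, a; split.
Qed.

(** The bound excludes arity 1, where [ad_I] is the identity and [[:: a]] may belong to it although
    [[:: a; a]] is too long for [X]. *)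
Lemma rel_mem_I X w a :
  2 <= arity X -> rel_mem (ad_I X) (w ++ [:: a]) <-> rel_mem X (w ++ [:: a; a]).
Proof.
move=> X2; rewrite /ad_I X2.
split=> [[t [u Xu [w' [a' [uE tE]]]] wE]|[u Xu uE]].
  move: tE; rewrite -wE !cats1 => /rcons_inj [-> ->].
  by exists u.
have sz : size (w ++ [:: a]) == (arity X).-1.
  by rewrite -(size_tuple u) -uE !size_cat addn1 addn2.
exists (Tuple sz) => //=; exists u => //.
by exists w, a; split.
Qed.

Lemma rel_mem_neg1 X t :
  arity X <= 1 -> size t = arity X -> rel_mem (ad_neg1 X) t <-> ~ rel_mem X t.
Proof.
move=> X1 /eqP tX; rewrite /ad_neg1 X1; split=> [[u /= Xu ->]|Xt].
  by rewrite rel_mem_tuple.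
by exists (Tuple tX) => //=; rewrite -rel_mem_tuple.
Qed.

Lemma cat_inj_size (s1 s2 t1 t2 : seq A) : size s1 = size s2 ->
  s1 ++ t1 = s2 ++ t2 -> s1 = s2 /\ t1 = t2.
Proof.
by elim: s1 s2 => [|a s1 IH] [|b s2] //= [/IH {}IH] [-> /IH [-> ->]].
Qed.

Lemma rel_mem_J X Y t w : size t = arity X ->
  rel_mem (ad_J X Y) (t ++ w) <-> rel_mem X t /\ rel_mem Y w.
Proof.
move=> tX; split=> [[_ [u [v [-> [Xu Yv]]]] /=]|[[u Xu ->] [v Yv ->]]].
  case/cat_inj_size => [|-> ->]; first by rewrite size_tuple.
  by split; apply/rel_mem_tuple.
by exists [tuple of u ++ v] => //=; exists u, v.
Qed.

Lemma rel_mem_Jbar X Y t w : size t = arity X -> size w = arity Y ->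
  rel_mem (ad_Jbar X Y) (t ++ w) <-> rel_mem X t \/ rel_mem Y w.
Proof.
move=> tX wY; split=> [[_ [u [v [-> XY]]] /=]|XY].
  case/cat_inj_size => [|-> ->]; first by rewrite size_tuple.
  by rewrite !rel_mem_tuple.
move/eqP in tX; move/eqP in wY.
exists [tuple of Tuple tX ++ Tuple wY] => //=.
exists (Tuple tX), (Tuple wY); split=> //.
by rewrite -!rel_mem_tuple.
Qed.

Lemma rel_mem_exists X t : 1 <= arity X ->
  rel_mem (ad_exists X) t <-> exists a, rel_mem X (rcons t a).
Proof.
move=> X1; rewrite /ad_exists X1; split=> [[v [u Xu [a uE]] ->]|[a [u Xu uE]]].
  by exists a; rewrite -uE; apply/rel_mem_tuple.
have sz : size t == (arity X).-1 by rewrite -(size_tuple u) -uE size_rcons.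
by exists (Tuple sz) => //=; exists u => //; exists a.
Qed.

Lemma rel_mem_e a b : rel_mem (ad_e A) [:: a; b] <-> a = b.
Proof.
split=> [[_ [c _ <-] [-> ->]]|->] //.
by exists [tuple b; b] => //=; exists b.
Qed.

End RelMem.

(** * Properties of lists closed under rotation, swapping and merging *)

Section ColumnLists.
Set Implicit Arguments.
Unset Strict Implicit.
Variables (V : eqType) (P : seq V -> Prop).
Hypothesis P_rotr : forall xs, P xs -> P (rotr 1 xs).
Hypothesis P_swap : forall w x y, P (w ++ [:: x; y]) -> P (w ++ [:: y; x]).

Lemma closed_rotC xs ys : P (xs ++ ys) -> P (ys ++ xs).
Proof.
elim/last_ind: ys xs => [|ys y IH] xs; first by rewrite cats0.
by rewrite -rcons_cat => /P_rotr; rewrite rotr1_rcons -cat_cons => /IH; rewrite cat_rcons.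
Qed.

(** Rotating [v] to the front puts the pair at the end, where [P_swap] applies; a second rotation
    restores the order. *)
Lemma closed_swap u x y v : P (u ++ x :: y :: v) -> P (u ++ y :: x :: v).
Proof.
have E (a b : V) : u ++ a :: b :: v = (u ++ [:: a; b]) ++ v by rewrite -catA.
rewrite !E => /closed_rotC; rewrite catA => /P_swap; rewrite -catA.
exact: closed_rotC.
Qed.

Lemma closed_move u x ys v : P (u ++ x :: ys ++ v) -> P (u ++ ys ++ x :: v).
Proof.
elim: ys u => [|y ys IH] u //= /closed_swap.
by rewrite -cat_rcons => /IH; rewrite cat_rcons.
Qed.

(** Permutations are generated by exchanges of adjacent blocks, and such an exchange moves the
    entries of one block past the other one at a time. *)
Lemma closed_perm xs ys : perm_eq xs ys -> P xs -> P ys.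
Proof.
apply: catCA_perm_ind => s1 s2 s3.
suff: forall u, P (u ++ s1 ++ s2 ++ s3) -> P (u ++ s2 ++ s1 ++ s3) by move/(_ [::]).
elim: s1 => [|x s1 IH] u //=; rewrite -cat_rcons => /IH.
by rewrite cat_rcons => /closed_move.
Qed.

Hypothesis P_merge : forall w x, P (w ++ [:: x; x]) -> P (w ++ [:: x]).

Lemma closed_undup xs : P xs -> P (undup xs).
Proof.
suff: forall w, P (w ++ xs) -> P (w ++ undup xs) by move/(_ [::]).
elim: xs => [|x xs IH] w //=; rewrite -cat_rcons => /IH.
rewrite cat_rcons; case: ifP => // xxs Pw.
(* The tail is already free of repetitions and still contains [x]. Its copy and the head are
   permuted to the end, where [P_merge] fuses them. *)
have xu : perm_eq (undup xs) (x :: rem x (undup xs)).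
  by apply: perm_to_rem; rewrite mem_undup.
have {}Pw : P ((w ++ rem x (undup xs)) ++ [:: x; x]).
  apply: closed_perm Pw; rewrite -catA perm_cat2l perm_sym perm_catC /=.
  by rewrite perm_cons perm_sym.
have := P_merge Pw; apply: closed_perm.
by rewrite -catA perm_cat2l perm_catC perm_sym.
Qed.

Lemma closed_uniq xs ys : uniq ys -> xs =i ys -> P xs -> P ys.
Proof.
move=> uys xys /closed_undup; apply: closed_perm.
by apply: uniq_perm; rewrite ?undup_uniq // => x; rewrite mem_undup.
Qed.

End ColumnLists.

(** * Satisfaction under renaming, and terms matched with formulas *)

Section Expresses.
Set Implicit Arguments.
Unset Strict Implicit.
Context {Sym : Type} {ar : Sym -> nat}.
Implicit Types (M : model ar) (T S : gra_term Sym) (phi psi : formula ar).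
Implicit Types (xs ys w : seq nat) (x y : nat).

Lemma sat_ext M (s s' : nat -> domain M) phi :
  {in free_occurrences phi, s =1 s'} -> sat s phi -> sat s' phi.
Proof.
(* The induction needs an equivalence, since negation reverses implications, and arbitrary
   assignments, since quantifiers update them. *)
suff: forall s s' : nat -> domain M, {in free_occurrences phi, s =1 s'} ->
  (sat s phi <-> sat s' phi) by move=> H /H ->.
elim: phi {s s'} => /= [x y|R ts|phi IH1 psi IH2|phi IH1 psi IH2|x phi IH|phi IH] s s' ss'.
- by rewrite !ss' // !inE eqxx ?orbT.
- suff -> : [tuple of map s ts] = [tuple of map s' ts] by [].
  by apply: val_inj => /=; apply/eq_in_map.
- have [ss1 ss2] : {in free_occurrences phi, s =1 s'} /\ {in free_occurrences psi, s =1 s'}.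
    by split=> z zi; apply: ss'; rewrite mem_cat zi ?orbT.
  by rewrite (IH1 _ _ ss1) (IH2 _ _ ss2).
- have [ss1 ss2] : {in free_occurrences phi, s =1 s'} /\ {in free_occurrences psi, s =1 s'}.
    by split=> z zi; apply: ss'; rewrite mem_cat zi ?orbT.
  by rewrite (IH1 _ _ ss1) (IH2 _ _ ss2).
- split=> -[a] sa; exists a; move: sa; apply IH => z zi;
    case: eqP => // /eqP zx; first by rewrite ss' // mem_filter zx.
  by rewrite ss' // mem_filter zx.
- by rewrite (IH _ _ ss').
Qed.

Fixpoint rename (f : nat -> nat) phi : formula ar :=
  match phi with
  | Eq x y => Eq _ (f x) (f y)
  | Rel R ts => Rel [tuple of map f ts]
  | And phi psi => And (rename f phi) (rename f psi)
  | Or phi psi => Or (rename f phi) (rename f psi)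
  | Ex x phi => Ex (f x) (rename f phi)
  | Neg phi => Neg (rename f phi)
  end.

Lemma free_occurrences_rename f phi : injective f ->
  free_occurrences (rename f phi) = map f (free_occurrences phi).
Proof.
move=> f_inj; elim: phi => //= [phi -> psi ->|phi -> psi ->|x phi ->];
  rewrite ?map_cat // filter_map; congr map.
by apply: eq_filter => y /=; rewrite (inj_eq f_inj).
Qed.

Lemma size_free_vars phi :
  size (free_vars phi) = size (undup (free_occurrences phi)).
Proof. by rewrite size_sort. Qed.

(** An injection preserves the number of distinct free variables, hence the side condition on
    negation. *)
Lemma unfo_rename f phi : injective f -> unfo (rename f phi) = unfo phi.
Proof.
move=> f_inj; elim: phi => //= [phi -> psi ->|phi -> psi ->|phi ->] //.
by rewrite !size_free_vars free_occurrences_rename // undup_map_inj // size_map.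
Qed.

(** At a quantifier, injectivity makes an update at [f x], pulled back along [f], an update at [x]
    alone. *)
Lemma sat_rename M f phi (s : nat -> domain M) : injective f ->
  sat s (rename f phi) <-> sat (s \o f) phi.
Proof.
move=> f_inj; elim: phi s => //= [R ts|phi IH1 psi IH2|phi IH1 psi IH2|x phi IH|phi IH] s.
- suff -> : [tuple of map s (map f ts)] = [tuple of map (s \o f) ts] by [].
  by apply: val_inj; rewrite /= -map_comp.
- by rewrite IH1 IH2.
- by rewrite IH1 IH2.
- by split=> -[a] sa; exists a; move: sa; rewrite IH; apply: sat_ext => z _ /=;
    rewrite (inj_eq f_inj).
- by rewrite IH.
Qed.

Lemma mem_free_vars phi : free_vars phi =i free_occurrences phi.
Proof. by move=> x; rewrite mem_sort mem_undup. Qed.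

Lemma free_vars_uniq phi : uniq (free_vars phi).
Proof. by rewrite sort_uniq undup_uniq. Qed.

Lemma free_vars_iota phi k : free_occurrences phi =i iota 0 k ->
  free_vars phi = iota 0 k.
Proof.
move=> phik; apply: (sorted_eq leq_trans anti_leq).
- exact: (sort_sorted leq_total).
- exact: iota_sorted.
- apply: uniq_perm; rewrite ?free_vars_uniq ?iota_uniq // => x.
  by rewrite mem_free_vars.
Qed.

(** All models are allowed, without the vocabulary condition of [equivalent], because [holds]
    interprets every symbol in every model. Whole assignments are used, so [map s xs] also makes
    sense for lists with repetitions. *)
Definition expresses phi xs T : Prop :=
  free_occurrences phi =i xs /\
  forall M, arity (term_rel M T) = size xs /\
    forall s : nat -> domain M, sat s phi <-> rel_mem (term_rel M T) (map s xs).

Lemma expresses_equivalent phi T : expresses phi (free_vars phi) T -> equivalent phi T.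
Proof.
case=> _ eT M _; have [aT sT] := eT M.
apply: ad_relation_eq => //= t; split=> [[u [s us sphi] ->]|Tt].
  by rewrite us; apply/sT.
have /eqP sz : size t = size (free_vars phi) by rewrite (rel_mem_size Tt).
have [d] := domain_nonempty M.
(* A variable that is not free has index [size t], so it receives the default [d]. *)
pose s x := nth d t (index x (free_vars phi)).
have ts : t = map s (free_vars phi).
  apply: (@eq_from_nth _ d); first by rewrite size_map (eqP sz).
  move=> i it; rewrite (eqP sz) in it.
  by rewrite (nth_map 0) // /s index_uniq ?free_vars_uniq.
by exists (Tuple sz) => //; exists s => //; apply/sT; rewrite -ts.
Qed.

(** * Effect of each operator on the matched formula and columns *)

Lemma expresses_p phi xs T : expresses phi xs T -> expresses phi (rotr 1 xs) (Tp T).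
Proof.
move=> [fphi eT]; split=> [x|M]; first by rewrite mem_rotr.
have [aT sT] := eT M; split=> [|s] /=; first by rewrite arity_ad_p size_rotr.
by rewrite rel_mem_p map_rotr rotrK.
Qed.

Lemma expresses_s phi w x y T :
  expresses phi (w ++ [:: x; y]) T -> expresses phi (w ++ [:: y; x]) (Ts T).
Proof.
move=> [fphi eT]; split=> [z|M].
  by rewrite fphi !mem_cat !inE (orbC (z == y)).
have [aT sT] := eT M; split=> [|s] /=; first by rewrite arity_ad_s aT !size_cat.
by rewrite map_cat rel_mem_s sT map_cat.
Qed.

Lemma expresses_I phi w x T :
  expresses phi (w ++ [:: x; x]) T -> expresses phi (w ++ [:: x]) (TI T).
Proof.
move=> [fphi eT]; split=> [z|M].
  by rewrite fphi !mem_cat !inE orbb.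
have [aT sT] := eT M; rewrite size_cat addn2 in aT.
split=> [|s] /=; first by rewrite arity_ad_I aT /= size_cat addn1.
by rewrite map_cat rel_mem_I ?aT // sT map_cat.
Qed.

Lemma expresses_small phi xs T : size xs <= 1 -> expresses phi xs T ->
  expresses phi xs (Ts T) /\ expresses phi xs (TI T).
Proof.
move=> xs1 [fphi eT].
have small M : (1 < arity (term_rel M T)) = false.
  by have [-> _] := eT M; rewrite ltnNge xs1.
by split; split=> // M; rewrite /= /ad_s /ad_I small; apply: eT.
Qed.

(** The bound [y] is forced to equal [x], so [T] itself expresses the new formula along [w ++
    [:: x; x]]. Quantifying avoids a substitution of [x] for [y], which would not be injective. *)
Lemma expresses_identify phi w x y T : x != y -> y \notin w ->
  expresses phi (w ++ [:: x; y]) T ->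
  expresses (Ex y (And phi (Eq _ x y))) (w ++ [:: x]) (TI T).
Proof.
move=> xy yw [fphi eT]; apply: expresses_I; split=> [z|M] /=.
  rewrite mem_filter !(mem_cat, inE) fphi !(mem_cat, inE).
  case: eqVneq => [->|_] /=; last by case: (z \in w); case: (z == x).
  by rewrite (negbTE yw) eq_sym (negbTE xy).
have [aT sT] := eT M; split=> [|s]; first by rewrite aT !size_cat.
have E a : map (fun z => if z == y then a else s z) (w ++ [:: x; y])
             = map s w ++ [:: s x; a].
  rewrite map_cat /= eqxx (negbTE xy); congr (_ ++ _).
  by apply/eq_in_map => z zw; case: eqP zw yw => // -> ->.
rewrite map_cat /= (negbTE xy) eqxx.
split=> [[a []]|Tx]; first by rewrite sT E => /[swap] <-.
by exists (s x); rewrite sT E.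
Qed.

Lemma expresses_exists phi xs x T : x \notin xs ->
  expresses phi (rcons xs x) T -> expresses (Ex x phi) xs (Texists T).
Proof.
move=> xxs [fphi eT]; split=> [z|M] /=.
  rewrite mem_filter fphi mem_rcons inE.
  by case: eqVneq => [->|_] //=; rewrite (negbTE xxs).
have [aT sT] := eT M; rewrite size_rcons in aT.
split=> [|s]; first by rewrite arity_ad_exists aT.
have E a : map (fun z => if z == x then a else s z) (rcons xs x)
             = rcons (map s xs) a.
  rewrite map_rcons eqxx; congr rcons.
  by apply/eq_in_map => z zxs; case: eqP zxs xxs => // -> ->.
rewrite rel_mem_exists ?aT //.
by split=> -[a]; rewrite ?sT ?E => Ta; exists a; rewrite ?sT ?E.
Qed.

Lemma expresses_exists_dummy phi xs x T : x \notin free_occurrences phi ->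
  expresses phi xs T -> expresses (Ex x phi) xs T.
Proof.
move=> xphi [fphi eT]; split=> [z|M] /=.
  rewrite mem_filter -fphi.
  by case: eqVneq => [->|_] //=; rewrite (negbTE xphi).
have [aT sT] := eT M; split=> // s; rewrite -sT.
(* The witness [s 0] is just some element of the domain; its value is irrelevant as [x] is not
   free. *)
by split=> [[a]|sphi]; [|exists (s 0); move: sphi]; apply: sat_ext => z zphi;
  case: eqP zphi xphi => // -> ->.
Qed.

Lemma expresses_neg phi xs T : size xs <= 1 ->
  expresses phi xs T -> expresses (Neg phi) xs (Tneg1 T).
Proof.
move=> xs1 [fphi eT]; split=> // M /=.
have [aT sT] := eT M; rewrite -aT in xs1.
split=> [|s]; first by rewrite /ad_neg1 xs1.
by rewrite rel_mem_neg1 ?size_map // sT.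
Qed.

(** Above arity 1 the operator yields the empty nullary relation, matched by a sentence that is
    false in every nonempty domain. *)
Lemma expresses_neg_large phi xs T : 1 < size xs -> expresses phi xs T ->
  expresses (Neg (Ex 0 (Eq _ 0 0))) [::] (Tneg1 T).
Proof.
move=> xs1 [_ eT]; split=> // M.
have [aT _] := eT M; rewrite -aT ltnNge in xs1.
rewrite /= /ad_neg1 (negbTE xs1) /=.
split=> // s; split=> [nex|[]] //.
by case: nex; exists (s 0).
Qed.

Lemma expresses_J phi psi xs ys T S : expresses phi xs T -> expresses psi ys S ->
  expresses (And phi psi) (xs ++ ys) (TJ T S).
Proof.
move=> [fphi eT] [fpsi eS]; split=> [z|M] /=; first by rewrite !mem_cat fphi fpsi.
have [aT sT] := eT M; have [aS sS] := eS M.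
split=> [|s]; first by rewrite aT aS size_cat.
by rewrite map_cat rel_mem_J ?size_map // sT sS.
Qed.

Lemma expresses_Jbar phi psi xs ys T S : expresses phi xs T -> expresses psi ys S ->
  expresses (Or phi psi) (xs ++ ys) (TJbar T S).
Proof.
move=> [fphi eT] [fpsi eS]; split=> [z|M] /=; first by rewrite !mem_cat fphi fpsi.
have [aT sT] := eT M; have [aS sS] := eS M.
split=> [|s]; first by rewrite aT aS size_cat.
by rewrite map_cat rel_mem_Jbar ?size_map // sT sS.
Qed.

Lemma expresses_e x y : expresses (Eq _ x y) [:: x; y] (Te _).
Proof. by split=> // M; split=> // s /=; rewrite rel_mem_e. Qed.

Lemma expresses_rel R (ts : (ar R).-tuple nat) : expresses (Rel ts) ts (TRel R).
Proof.
split=> // M; split=> [|s] /=; first by rewrite size_tuple.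
exact: iff_sym (rel_mem_tuple (X := ADRelation (ar R) _) [tuple of map s ts]).
Qed.

Lemma expresses_rename f phi xs T : injective f ->
  expresses phi xs T -> expresses (rename f phi) (map f xs) T.
Proof.
move=> f_inj [fphi eT]; split=> [x|M].
  by rewrite free_occurrences_rename //; apply: eq_mem_map.
have [aT sT] := eT M; split=> [|s]; first by rewrite size_map.
by rewrite sat_rename // sT map_comp.
Qed.

(** * From formulas to terms *)

Lemma expresses_uniq phi xs ys T : uniq ys -> xs =i ys ->
  expresses phi xs T -> exists T', expresses phi ys T'.
Proof.
move=> uys xys eT.
(* The formula stays fixed while the term varies: [p], [s] and [I] supply the three closure
   properties. *)
apply: (closed_uniq (P := fun zs => exists S, expresses phi zs S) _ _ _ uys xys).
- by move=> zs [S /expresses_p]; exists (Tp S).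
- by move=> w x y [S /expresses_s]; exists (Ts S).
- by move=> w x [S /expresses_I]; exists (TI S).
- by exists T.
Qed.

Lemma expresses_free_vars phi xs T :
  expresses phi xs T -> exists T', expresses phi (free_vars phi) T'.
Proof.
move=> eT; apply: (expresses_uniq (free_vars_uniq phi) _ eT) => x.
by rewrite mem_free_vars; case: eT.
Qed.

Lemma unfo_expressed phi : unfo phi -> exists T, expresses phi (free_vars phi) T.
Proof.
elim: phi => /= [x y|R ts|phi IH1 psi IH2|phi IH1 psi IH2|x phi IH|phi IH].
- by move=> _; apply: expresses_free_vars (expresses_e x y).
- by move=> _; apply: expresses_free_vars (expresses_rel ts).
- move=> /andP[/IH1 [T eT] /IH2 [S eS]].
  exact: expresses_free_vars (expresses_J eT eS).
- move=> /andP[/IH1 [T eT] /IH2 [S eS]].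
  exact: expresses_free_vars (expresses_Jbar eT eS).
- move=> /IH [T eT]; have [xphi|xphi] := boolP (x \in free_occurrences phi); last first.
    exact: expresses_free_vars (expresses_exists_dummy xphi eT).
  (* Projection removes the last column, so [x] is brought there first. *)
  pose ys := rem x (free_vars phi).
  have uys : uniq (rcons ys x).
    by rewrite rcons_uniq rem_uniq ?free_vars_uniq // mem_rem_uniqF ?free_vars_uniq.
  have xys : free_vars phi =i rcons ys x.
    move=> z; rewrite mem_rcons; apply: perm_mem; apply: perm_to_rem.
    by rewrite mem_free_vars.
  have [S eS] := expresses_uniq uys xys eT.
  apply: expresses_free_vars (expresses_exists _ eS).
  by move: uys; rewrite rcons_uniq => /andP[].
- move=> /andP[/IH [T eT] phi1].
  exact: expresses_free_vars (expresses_neg phi1 eT).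
Qed.

(** * From terms to formulas *)

Definition definable k T : Prop :=
  exists2 phi, unfo phi & expresses phi (iota 0 k) T.

(** Renaming each variable to its position in [xs] restores the standard column order. *)
Lemma definable_perm phi xs T k : perm_eq xs (iota 0 k) ->
  unfo phi -> expresses phi xs T -> definable k T.
Proof.
move=> xsk uphi eT.
have uxs : uniq xs by rewrite (perm_uniq xsk) iota_uniq.
have szxs : size xs = k by rewrite (perm_size xsk) size_iota.
have mxs z : (z \in xs) = (z < k) by rewrite (perm_mem xsk) mem_iota.
(* Being the identity from [k] on, [f] is injective on all variables, bound ones included. *)
pose f z := if z < k then index z xs else z.
have fk z : (f z < k) = (z < k).
  by rewrite /f; case: ifP => // zk; rewrite -[X in _ < X]szxs index_mem mxs.
have f_inj : injective f.
  move=> y z fyz; have := fk y; rewrite fyz fk.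
  move: fyz; rewrite /f; case: ifP => yk; case: ifP => zk // fyz _.
  by rewrite -(nth_index 0 (_ : y \in xs)) ?mxs // fyz nth_index ?mxs.
have fxs : map f xs = iota 0 k.
  apply: (@eq_from_nth _ 0) => [|i]; rewrite size_map ?size_iota // => ixs.
  by rewrite (nth_map 0) // /f -mxs mem_nth // index_uniq // nth_iota -?szxs.
exists (rename f phi); first by rewrite unfo_rename.
by rewrite -fxs; apply: expresses_rename.
Qed.

(** Prepares [J] and [Jbar]: after the shift the columns continue [iota 0 k] to [iota 0 (k + l)]. *)
Lemma expresses_shift psi S k l : expresses psi (iota 0 l) S ->
  expresses (rename (addn k) psi) (iota k l) S.
Proof.
by rewrite -{2}[k]addn0 iotaDl => eS; apply: expresses_rename => //; apply: addnI.
Qed.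

Lemma term_definable T : exists k, definable k T.
Proof.
have iota2 k : iota 0 k.+2 = iota 0 k ++ [:: k; k.+1] by rewrite -addn2 iotaD.
have iota1 k : iota 0 k.+1 = iota 0 k ++ [:: k] by rewrite -addn1 iotaD.
have small k phi S : k <= 1 -> expresses phi (iota 0 k) S ->
    expresses phi (iota 0 k) (Ts S) /\ expresses phi (iota 0 k) (TI S).
  by move=> k1; apply: expresses_small; rewrite size_iota.
elim: T => [R||T [k [phi uphi eT]]|T [k [phi uphi eT]]|T [k [phi uphi eT]]
  |T [k [phi uphi eT]]|T [k [phi uphi eT]] S [l [psi upsi eS]]
  |T [k [phi uphi eT]] S [l [psi upsi eS]]|T [k [phi uphi eT]]].
- by exists (ar R), (Rel (iota_tuple (ar R) 0)) => //; apply: expresses_rel.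
- by exists 2, (Eq _ 0 1) => //; apply: expresses_e.
- exists k; apply: definable_perm (expresses_p eT) => //.
  by rewrite perm_rotr.
- case: k eT => [|[|k]] eT.
  + by exists 0, phi => //; case: (small 0 phi T).
  + by exists 1, phi => //; case: (small 1 phi T).
  rewrite iota2 in eT; exists k.+2; apply: definable_perm (expresses_s eT) => //.
  by rewrite iota2 perm_cat2l (perm_catC [:: _] [:: _]).
- case: k eT => [|[|k]] eT.
  + by exists 0, phi => //; case: (small 0 phi T).
  + by exists 1, phi => //; case: (small 1 phi T).
  rewrite iota2 in eT; exists k.+1, (Ex k.+1 (And phi (Eq _ k k.+1))).
    by rewrite /= uphi.
  rewrite iota1; apply: expresses_identify => //; first by rewrite neq_ltn ltnSn.
  by rewrite mem_iota /= add0n ltnNge leqnSn.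
- have [k1|k1] := leqP k 1.
    exists k, (Neg phi) => /=; last by apply: expresses_neg; rewrite ?size_iota.
    (* The formula has exactly [k] free variables, so [k <= 1] is the side condition on negation. *)
    by rewrite uphi (free_vars_iota eT.1) size_iota.
  exists 0, (Neg (Ex 0 (Eq _ 0 0))) => //.
  by apply: expresses_neg_large eT; rewrite size_iota.
- exists (k + l), (And phi (rename (addn k) psi)).
    by rewrite /= uphi unfo_rename //; apply: addnI.
  by rewrite iotaD; apply: expresses_J eT (expresses_shift k eS).
- exists (k + l), (Or phi (rename (addn k) psi)).
    by rewrite /= uphi unfo_rename //; apply: addnI.
  by rewrite iotaD; apply: expresses_Jbar eT (expresses_shift k eS).
- case: k eT => [|k] eT.
    exists 0, phi => //; case: eT => fphi eT; split=> // M /=.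
    have [aT sT] := eT M.
    have X0 : (1 <= arity (term_rel M T)) = false by rewrite aT.
    by rewrite /ad_exists X0.
  exists k, (Ex k phi) => //; rewrite iota1 cats1 in eT.
  by apply: expresses_exists eT; rewrite mem_iota add0n ltnn.
Qed.

End Expresses.

Theorem proposition9p2 (Sym : Type) (ar : Sym -> nat) :
  (forall phi : formula ar, unfo phi ->
     exists T : gra_term Sym, equivalent phi T) /\
  (forall T : gra_term Sym,
     exists phi : formula ar, unfo phi /\ equivalent phi T).
Proof.
split=> [phi /unfo_expressed [T eT]|T].
  by exists T; apply: expresses_equivalent.
have [k [phi uphi eT]] := @term_definable Sym ar T.
exists phi; split=> //; apply: expresses_equivalent.
(* The columns [iota 0 k] are already the free variables in increasing order, as [equivalent]
   demands. *)
by rewrite (free_vars_iota eT.1).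
Qed.
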